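(* Let $\mathbf{y}=\mathbf{G}(x,\mathbf{y})$ be a well-conditioned system with extreme point $(\rho,\boldsymbol{\tau})$, and let $\mathcal{CP}$ be its set of characteristic points. Suppose $(\rho,\boldsymbol{\tau})$ is a characteristic point of the system. Then: (a) $\rho$ is the largest first coordinate of any characteristic point, that is, $\rho=\max\{a:(a,\mathbf{b})\in\mathcal{CP}\}$; (b) $(\rho,\boldsymbol{\tau})$ is the only characteristic point whose first coordinate is $\rho$.
   Context: Let $m\ge 1$ and $\mathbf{y}=(y_1,\dots,y_m)$. A system $\mathbf{y}=\mathbf{G}(x,\mathbf{y})$ means $y_i=G_i(x,y_1,\dots,y_m)$, $1\le i\le m$, where the $G_i$ are power series; its Jacobian matrix is $J_{\mathbf{G}}(x,\mathbf{y})=\big(\partial G_i/\partial y_j\big)_{1\le i,j\le m}$ (no derivative in $x$). The system is well-conditioned if: (a) each $G_i(x,\mathbf{y})$ is a power series with nonnegative real coefficients; (b) $\mathbf{G}$ is holomorphic in a neighborhood of the origin; (c) $\mathbf{G}(0,\mathbf{y})=\mathbf{0}$; (d) $G_i(x,\mathbf{0})\ne 0$ for all $i$; (e) the system is irreducible, i.e. the nonnegative matrix of power series $J_{\mathbf{G}}$ is irreducible (the directed graph on $\{1,\dots,m\}$ with an edge $i\to j$ whenever $\partial G_i/\partial y_j\neq 0$ is strongly connected); (f) $\partial^2 G_i/\partial y_j\partial y_k\ne 0$ for some $i,j,k$. For a well-conditioned system there is a unique vector $\mathbf{T}(x)=(T_1(x),\dots,T_m(x))$ of formal power series with nonnegative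 coefficients such that $\mathbf{T}(x)=\mathbf{G}(x,\mathbf{T}(x))$ formally (it satisfies $\mathbf{T}(0)=\mathbf{0}$); it is called the standard solution. It is a standard fact that all $T_i$ have the same radius of convergence $\rho\in(0,\infty)$ and that $\tau_i:=T_i(\rho)<\infty$. With $\boldsymbol{\tau}=(\tau_1,\dots,\tau_m)$, the point $(\rho,\boldsymbol{\tau})$ is the extreme point of the system. A characteristic point of the system is a point $(a,\mathbf{b})\in\mathbb{R}^{m+1}$ with all coordinates positive that solves the characteristic system $\mathbf{y}=\mathbf{G}(x,\mathbf{y})$, $\det\big(I-J_{\mathbf{G}}(x,\mathbf{y})\big)=0$ (in particular the series $G_i$ and $\partial G_i/\partial y_j$ converge at $(a,\mathbf{b})$). *)

(* Defs.v *)
From HB Require Import structures.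
From mathcomp Require Import all_boot all_order all_algebra.
From mathcomp Require Import complex.
From mathcomp Require Import all_classical all_reals all_analysis.

Set Implicit Arguments.
Unset Strict Implicit.
Unset Printing Implicit Defensive.

Import Order.TTheory GRing.Theory Num.Theory.
Import numFieldNormedType.Exports.
Import ComplexField.

Local Open Scope classical_set_scope.
Local Open Scope ring_scope.

(* A formal power series in x, y_1, ..., y_m is its family of coefficients:
   [f n k] is the coefficient of x^n y_1^(k 1) ... y_m^(k m). *)
Definition multiseries (R : Type) (m : nat) := nat -> {ffun 'I_m -> nat} -> R.

Section MultivariateSeries.
Variables (R : realType) (m : nat).
Implicit Types (f : multiseries R m) (n : nat) (k : {ffun 'I_m -> nat}).

Definition multiseries_neq0 f : Prop := exists n k, f n k != 0.

(* The formal partial derivative with respect to y_j. *)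
Definition dy (j : 'I_m) f : multiseries R m :=
  fun n k => (k j).+1%:R * f n [ffun l => (k l + (l == j))%N].

(* The value of f at (a, b), +oo when the series diverges. As [esum] is the
   supremum of the finite partial sums, this is meaningful only when all the
   terms are nonnegative, e.g., for nonnegative coefficients and a, b >= 0. *)
Definition multiseries_val f (a : R) (b : 'rV[R]_m) : \bar R :=
  \esum_(p in [set: nat * {ffun 'I_m -> nat}])
    (f p.1 p.2 * a ^+ p.1 * \prod_(j < m) b 0 j ^+ p.2 j)%:E.

(* The series converges absolutely on a complex polydisc centred at 0. *)
Definition holomorphic_near0 f : Prop :=
  exists2 r : R, 0 < r &
    forall (x : R[i]) (y : 'I_m -> R[i]),
      Normc.normc x < r -> (forall j, Normc.normc (y j) < r) ->
      summable [set: nat * {ffun 'I_m -> nat}]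
        (fun p => (Normc.normc ((f p.1 p.2)%:C%C * x ^+ p.1 *
                          \prod_(j < m) y j ^+ p.2 j))%:E).

(* The coefficient of x^N in f(x, t_1(x), ..., t_m(x)), for univariate series
   t_j with t_j(0) = 0. Since x^n t_1^(k 1) ... t_m^(k m) has order at least
   n + sum_j k j, only the terms with n, k j <= N contribute, and only the
   coefficients of degree <= N of the t_j matter. *)
Definition subst_coef f (t : 'I_m -> nat -> R) (N : nat) : R :=
  \sum_(n < N.+1) \sum_(k : {ffun 'I_m -> 'I_N.+1})
    f n [ffun j => k j : nat] *
      ('X^n * \prod_(j < m) (\poly_(l < N.+1) t j l) ^+ k j)`_N.

End MultivariateSeries.

Section Systems.
Variables (R : realType) (m : nat).
Implicit Types (G : 'I_m -> multiseries R m) (t : 'I_m -> nat -> R).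

Definition dependency G : rel 'I_m :=
  fun i j => `[< multiseries_neq0 (dy j (G i)) >].

Record well_conditioned G : Prop := WellConditioned {
  wc_ge0 : forall i n k, 0 <= G i n k;
  wc_holomorphic : forall i, holomorphic_near0 (G i);
  wc_x0 : forall i k, G i 0%N k = 0;
  wc_y0 : forall i, exists n, G i n [ffun=> 0%N] != 0;
  wc_irreducible : forall i j, connect (dependency G) i j;
  wc_nonlinear : exists i j k, multiseries_neq0 (dy k (dy j (G i)))
}.

Record standard_solution G t : Prop := StandardSolution {
  ss_ge0 : forall i n, 0 <= t i n;
  ss_0 : forall i, t i 0%N = 0;
  ss_fixpoint : forall i N, t i N = subst_coef (G i) t N
}.

Definition conv_radius (u : nat -> R) : \bar R :=
  ereal_sup [set `|x|%:E | x in [set x : R | cvgn (pseries u x)]].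

Definition extreme_point G (rho : R) (tau : 'rV[R]_m) : Prop :=
  exists2 t, standard_solution G t &
    forall i, conv_radius (t i) = rho%:E /\
              pseries (t i) rho @ \oo --> tau 0 i.

Definition jacobian_y G (a : R) (b : 'rV[R]_m) : 'M[R]_m :=
  \matrix_(i, j) fine (multiseries_val (dy j (G i)) a b).

Record characteristic_point G (a : R) (b : 'rV[R]_m) : Prop :=
  CharacteristicPoint {
    cp_a_gt0 : 0 < a;
    cp_b_gt0 : forall j, 0 < b 0 j;
    cp_solution : forall i, multiseries_val (G i) a b = (b 0 i)%:E;
    cp_jacobian_cvg : forall i j, (multiseries_val (dy j (G i)) a b < +oo)%E;
    cp_det : \det (1%:M - jacobian_y G a b) = 0
  }.

End Systems.

(* Main.v *)
(* If (a, b) solves y = G(x, y) with nonnegative coordinates, then by induction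
   on N the partial sums of T_i(a) are at most b_i, because the coefficients of
   G are nonnegative and G(0, y) = 0. Hence T converges at a, so a <= rho, and
   if a = rho then tau <= b.
   Suppose b <> tau with a = rho, and put d = b - tau >= 0, A = J_G(rho, tau).
   Expanding each monomial at tau gives G(rho, b) - G(rho, tau) >= A d, that is
   A d <= d, with strict inequality in some coordinate as soon as d > 0, since
   G is nonlinear. Irreducibility of A gives d > 0, and then det(I - A) = 0
   forces A d = d, a contradiction. *)
Require Import Defs.
From mathcomp Require Import all_boot all_order all_algebra.
From mathcomp Require Import ring lra.
From mathcomp Require Import all_classical all_reals all_analysis.

Import Order.TTheory GRing.Theory Num.Theory.
Import numFieldNormedType.Exports.

Set Implicit Arguments.
Unset Strict Implicit.
Unset Printing Implicit Defensive.

Local Open Scope classical_set_scope.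
Local Open Scope ring_scope.

(** * Subinvariant vectors of irreducible nonnegative matrices *)

Section Irreducible.
Variables (R : realType) (m : nat) (A : 'M[R]_m) (d : 'I_m -> R).
Hypotheses (A_ge0 : forall i j, 0 <= A i j).
Hypothesis A_irr : forall i j, connect [rel i j | 0 < A i j] i j.
Hypothesis d_ge0 : forall i, 0 <= d i.
Hypothesis Ad_le : forall i, \sum_j A i j * d j <= d i.

(** Positivity travels backwards along a path to [i0]: an edge from [i] to [j] with [0 < d j] makes
    [A i j * d j] a positive lower bound for [d i]. *)
Lemma subinvariant_gt0 i0 : 0 < d i0 -> forall i, 0 < d i.
Proof.
move=> di0 i; have /connectP[p] := A_irr i i0.
elim: p i => [|j p IHp] i /=; first by move=> _ <-.
move=> /andP[Aij pth] lst.
apply: lt_le_trans (Ad_le i); rewrite (bigD1 j) //= ltr_pwDl //.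
  by rewrite mulr_gt0 // IHp.
by apply: sumr_ge0 => l _; rewrite mulr_ge0.
Qed.

(* Pairing [A d <= d] with the absolute value of a left eigenvector of [A] for
   the eigenvalue 1 forces equality; no Perron-Frobenius theory is needed. *)
Lemma subinvariant_eq i0 : 0 < d i0 -> \det (1%:M - A) = 0 ->
  forall i, \sum_j A i j * d j = d i.
Proof.
move=> di0 /eqP/det0P[v v_neq0]; rewrite mulmxBr mulmx1 => /eqP.
rewrite subr_eq0 => /eqP vA.
have d_gt0 := subinvariant_gt0 di0.
pose w i := `|v 0 i|.
have w_ge0 i : 0 <= w i by exact: normr_ge0.
have w_le j : w j <= \sum_i w i * A i j.
  rewrite /w {1}vA mxE; apply: le_trans (ler_norm_sum _ _ _) _.
  by apply: ler_sum => i _; rewrite normrM (ger0_norm (A_ge0 _ _)).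
have swap : \sum_j (\sum_i w i * A i j) * d j = \sum_i w i * \sum_j A i j * d j.
  under eq_bigr do rewrite mulr_suml.
  rewrite exchange_big /=; apply: eq_bigr => i _.
  by rewrite mulr_sumr; apply: eq_bigr => j _; rewrite mulrA.
have wAd_le i : w i * \sum_j A i j * d j <= w i * d i by rewrite ler_wpM2l.
have le_wAd j : w j * d j <= (\sum_i w i * A i j) * d j by rewrite ler_wpM2r.
(* The chain w d <= (w A) d = w (A d) <= w d closes up, so both inequalities are equalities;
   positivity of [d], then of [w], turns them into coordinatewise ones. *)
have eq1 : \sum_j w j * d j = \sum_j (\sum_i w i * A i j) * d j.
  by apply: le_anti; rewrite ler_sum //= swap; exact: ler_sum.
have wA j : \sum_i w i * A i j = w j.
  have /eqP : \sum_j ((\sum_i w i * A i j) * d j - w j * d j) = 0.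
    by rewrite sumrB eq1 subrr.
  rewrite psumr_eq0 => [|l _]; last by rewrite subr_ge0.
  move=> /allP/(_ j (mem_index_enum j))/=.
  by rewrite subr_eq0 => /eqP/mulIf-> //; rewrite gt_eqF.
have [i1 wi1] : exists i, 0 < w i.
  by have /rV0Pn[i vi] := v_neq0; exists i; rewrite normr_gt0.
(* From w A = w, an edge from [i1] to [j] gives [w i1 * A i1 j <= w j], so positivity spreads
   forwards from [i1]. *)
have w_gt0 i : 0 < w i.
  have /connectP[p] := A_irr i1 i.
  elim: p i1 wi1 => [|j p IHp] i1 wi1 /=; first by move=> _ ->.
  move=> /andP[Aij pth] lst; apply: (IHp j) => //.
  rewrite -wA (bigD1 i1) //= ltr_pwDl ?mulr_gt0 //.
  by apply: sumr_ge0 => l _; rewrite mulr_ge0.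
move=> i; have /eqP : \sum_i (w i * d i - w i * \sum_j A i j * d j) = 0.
  by rewrite sumrB eq1 swap subrr.
rewrite psumr_eq0 => [|l _]; last by rewrite subr_ge0.
move=> /allP/(_ i (mem_index_enum i))/=.
by rewrite subr_eq0 => /eqP/mulfI-> //; rewrite gt_eqF.
Qed.

End Irreducible.

(** * Monomials and their first-order expansion *)

Definition incr (m : nat) (j : 'I_m) (k : {ffun 'I_m -> nat}) :
    {ffun 'I_m -> nat} := [ffun l => (k l + (l == j))%N].

Lemma incr_inj (m : nat) (j : 'I_m) : injective (incr j).
Proof.
move=> k1 k2 /ffunP e; apply/ffunP => l; have := e l.
by rewrite !ffunE => /addIn.
Qed.

(** Induction on the total degree; it lets statements on monomials be proved by multiplying in one
    variable at a time. *)
Lemma incr_ind (m : nat) (P : {ffun 'I_m -> nat} -> Prop) :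
  P [ffun=> 0%N] -> (forall j k, P k -> P (incr j k)) -> forall k, P k.
Proof.
move=> P0 Pincr k; have [n] := ubnP (\sum_l k l)%N.
elim: n k => // n IHn k; rewrite ltnS => kn.
have [/forallP k0|/forallPn[j kj]] := boolP [forall l, k l == 0%N].
  suff -> : k = [ffun=> 0%N] by [].
  by apply/ffunP => l; rewrite ffunE; apply/eqP.
pose k' : {ffun 'I_m -> nat} := [ffun l => (k l - (l == j))%N].
have kE : k = incr j k'.
  apply/ffunP => l; rewrite !ffunE subnK //.
  by case: eqP => // ->; rewrite lt0n.
rewrite kE; apply/Pincr/IHn; apply: leq_trans kn.
rewrite (bigD1 j) //= [X in (_ < X)%N](bigD1 j) //= -addSn leq_add //.
  by rewrite ffunE eqxx subn1 prednK // lt0n.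
by apply: leq_sum => l _; rewrite ffunE leq_subr.
Qed.

Section Monomials.
Variables (R : realType) (m : nat).
Implicit Types (u d : 'I_m -> R) (k : 'I_m -> nat).

Definition mon u k : R := \prod_l u l ^+ k l.

Lemma mon_ge0 u k : (forall l, 0 <= u l) -> 0 <= mon u k.
Proof. by move=> u0; apply: prodr_ge0 => l _; rewrite exprn_ge0. Qed.

Lemma mon_gt0 u k : (forall l, 0 < u l) -> 0 < mon u k.
Proof. by move=> u0; apply: prodr_gt0 => l _; rewrite exprn_gt0. Qed.

Lemma mon_incr u j (k : {ffun 'I_m -> nat}) : mon u (incr j k) = u j * mon u k.
Proof.
rewrite /mon (bigD1 j) //= [in RHS](bigD1 j) //= ffunE eqxx addn1 exprS mulrA.
by congr (_ * _); apply: eq_bigr => l /negbTE lj; rewrite ffunE lj addn0.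
Qed.

(* The value at [u] of the derivative in [y_j]; the truncated subtraction is
   harmless since the factor [k j] vanishes when [k j = 0]. *)
Definition dmon u k j : R := (k j)%:R * mon u (fun l => (k l - (l == j))%N).

Lemma dmon_ge0 u k j : (forall l, 0 <= u l) -> 0 <= dmon u k j.
Proof. by move=> u0; rewrite mulr_ge0 ?ler0n ?mon_ge0. Qed.

Lemma dmon_incr_id u (k : {ffun 'I_m -> nat}) j :
  dmon u (incr j k) j = (k j).+1%:R * mon u k.
Proof.
rewrite /dmon ffunE eqxx addn1; congr (_ * _).
by apply: eq_bigr => l _; rewrite ffunE addnK.
Qed.

(** The Leibniz rule for the product of y_j and a monomial. A zero exponent is treated apart,
    because truncated subtraction does not lower it. *)
Lemma dmon_incr u j (k : {ffun 'I_m -> nat}) i :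
  dmon u (incr j k) i = u j * dmon u k i + (i == j)%:R * mon u k.
Proof.
have [->|/negbTE ij] := eqVneq i j.
  rewrite dmon_incr_id mul1r -addn1 natrD mulrDl mul1r /dmon; congr (_ + _).
  case kj : (k j) => [|n]; first by rewrite !mul0r mulr0.
  rewrite mulrCA; congr (_ * _); rewrite /mon (bigD1 j) //= kj.
  rewrite [in RHS](bigD1 j) //= eqxx kj subn1 exprS mulrA; congr (_ * _).
  by apply: eq_bigr => l /negbTE->; rewrite subn0.
rewrite mul0r addr0 /dmon ffunE ij addn0.
case ki : (k i) => [|n]; first by rewrite !mul0r mulr0.
rewrite mulrCA; congr (_ * _); rewrite /mon (bigD1 j) //=.
rewrite [in RHS](bigD1 j) //= ffunE eqxx [j == i]eq_sym ij !subn0 addn1 exprS.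
rewrite mulrA.
by congr (_ * _); apply: eq_bigr => l /negbTE lj; rewrite ffunE lj addn0.
Qed.

(** The derivative of the monomial at [u] in the direction [d]. *)
Definition linmon u d k : R := \sum_j dmon u k j * d j.

Lemma linmon_incr u d j (k : {ffun 'I_m -> nat}) :
  linmon u d (incr j k) = u j * linmon u d k + d j * mon u k.
Proof.
rewrite /linmon; under eq_bigr do rewrite dmon_incr mulrDl -mulrA.
rewrite big_split /= -mulr_sumr; congr (_ + _).
rewrite (bigD1 j) //= eqxx mul1r mulrC big1 ?addr0 // => i /negbTE->.
by rewrite !mul0r.
Qed.

Section Tangent.
Variables (u d : 'I_m -> R).
Hypotheses (u_ge0 : forall j, 0 <= u j) (d_ge0 : forall j, 0 <= d j).
Let b j := u j + d j.

Lemma linmon_ge0 k : 0 <= linmon u d k.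
Proof. by apply: sumr_ge0 => j _; rewrite mulr_ge0 // dmon_ge0. Qed.

(** Multiply the hypothesis by [u j + d j] and expand. The second-order term [d j * linmon u d k] is
    kept because strictness will come from it. *)
Lemma tangent_mon_incr j (k : {ffun 'I_m -> nat}) :
  mon u k + linmon u d k <= mon b k ->
  mon u (incr j k) + linmon u d (incr j k) + d j * linmon u d k
    <= mon b (incr j k).
Proof.
move=> h; rewrite !mon_incr linmon_incr.
apply: le_trans (ler_wpM2l _ h); last by rewrite addr_ge0.
rewrite /b; lra.
Qed.

Lemma tangent_mon (k : {ffun 'I_m -> nat}) :
  mon u k + linmon u d k <= mon b k.
Proof.
elim/incr_ind: k => [|j k IHk].
  rewrite /mon /linmon !big1 ?addr0 //= => i _; rewrite ?ffunE ?expr0 //.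
  by rewrite /dmon ffunE !mul0r.
apply: le_trans (tangent_mon_incr j IHk).
by rewrite lerDl mulr_ge0 // linmon_ge0.
Qed.

(** The linear part of [incr i k] contains [d i * mon u k > 0], so the second-order term produced by
    the factor y_j is positive. *)
Lemma tangent_mon_lt i j (k : {ffun 'I_m -> nat}) :
  (forall l, 0 < u l) -> 0 < d i -> 0 < d j ->
  mon u (incr j (incr i k)) + linmon u d (incr j (incr i k))
    < mon b (incr j (incr i k)).
Proof.
move=> u_gt0 di dj; apply: lt_le_trans (tangent_mon_incr j (tangent_mon _)).
rewrite ltrDl mulr_gt0 // linmon_incr ltr_wpDl ?mulr_gt0 ?mon_gt0 //.
by rewrite mulr_ge0 // linmon_ge0.
Qed.

End Tangent.
End Monomials.

(** * Sums of nonnegative extended real families *)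

Lemma le_esum_inj (R : realType) (T T' : choiceType) (h : T -> T')
    (a : T' -> \bar R) :
  injective h -> (forall y, (0 <= a y)%E) ->
  (\esum_(x in [set: T]) a (h x) <= \esum_(y in [set: T']) a y)%E.
Proof.
move=> hI a0; rewrite -esum_image => [|x y _ _]; last exact: hI.
rewrite esum_mkcond; apply: le_esum => y _.
by case: ifP.
Qed.

Lemma esum_finType (R : realType) (T : finType) (a : T -> \bar R) :
  (forall x, (0 <= a x)%E) ->
  (\esum_(x in [set: T]) a x = \sum_x a x)%E.
Proof.
move=> a0.
(* Each term becomes a finite sum of point masses, so that the two summations can be exchanged. *)
transitivity (\esum_(x in [set: T]) \sum_y if x == y then a y else 0)%E.
  by apply: eq_esum => x _; rewrite -big_mkcond (big_pred1 x).
rewrite esum_sum => [|x y _ _]; last by case: ifP.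
apply: eq_bigr => y _; rewrite -[RHS]esum_set1 // [RHS]esum_mkcond.
apply: eq_esum => x _; rewrite in_set1.
by case: eqP => // ->.
Qed.

Lemma esumZl (R : realType) (T : choiceType) (a : T -> \bar R) (c : R) :
  0 <= c -> (forall x, (0 <= a x)%E) ->
  (\esum_(x in [set: T]) (c%:E * a x) = c%:E * \esum_(x in [set: T]) a x)%E.
Proof.
move=> c0 a0; rewrite /esum -ereal_supZl //; last first.
  apply/set0P; exists 0%E; exists set0; first exact: fsets_set0.
  by rewrite fsbig_set0.
congr ereal_sup; rewrite image_comp.
apply: eq_imagel => X [finX _].
by rewrite -ge0_mule_fsumr.
Qed.

Lemma esum_le_term (R : realType) (T : choiceType) (a : T -> \bar R) x :
  (forall y, (0 <= a y)%E) -> (a x <= \esum_(y in [set: T]) a y)%E.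
Proof.
move=> a0; rewrite (esumID [set x]) // setTI esum_set1 //.
by rewrite leeDl // esum_ge0.
Qed.

(** * Values of multiseries and their tangent inequality *)

Section Values.
Variables (R : realType) (m : nat).
Implicit Types (f : multiseries R m) (a : R) (u b : 'rV[R]_m).

Lemma multiseries_valE f a b : multiseries_val f a b =
  (\esum_(p in [set: nat * {ffun 'I_m -> nat}])
     (f p.1 p.2 * a ^+ p.1 * mon (b 0) p.2)%:E)%E.
Proof. by []. Qed.

(** The exponent shift in [dy] is [incr j], so the left side is the part of the right sum over the
    image of [incr j], and the other terms are nonnegative. *)
Lemma dy_val_le f a u j :
  (forall n k, 0 <= f n k) -> 0 <= a -> (forall l, 0 <= u 0 l) ->
  (multiseries_val (dy j f) a u <=
   \esum_(p in [set: nat * {ffun 'I_m -> nat}])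
     (f p.1 p.2 * a ^+ p.1 * dmon (u 0) p.2 j)%:E)%E.
Proof.
move=> f0 a0 u0; pose h (p : nat * {ffun 'I_m -> nat}) := (p.1, incr j p.2).
pose F (p : nat * {ffun 'I_m -> nat}) :=
  (f p.1 p.2 * a ^+ p.1 * dmon (u 0) p.2 j)%:E.
rewrite multiseries_valE; apply: le_trans (@le_esum_inj _ _ _ h F _ _).
- apply: le_esum => -[n k] _; rewrite /F /h /= dmon_incr_id lee_fin.
  by rewrite /dy -/(incr j k) mulrCA !mulrA.
- by move=> [n k] [n' k'] [-> /incr_inj->].
- by move=> p; rewrite /F /= lee_fin mulr_ge0 ?dmon_ge0 // mulr_ge0 ?exprn_ge0.
Qed.

(** The tangent inequality of monomials, summed. All terms are nonnegative, so the sums split even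
    when infinite. One gap [r p] is retained, to give strictness at a well-chosen [p]. *)
Lemma multiseries_tangent f a u b :
  (forall n k, 0 <= f n k) -> 0 <= a ->
  (forall l, 0 <= u 0 l) -> (forall l, u 0 l <= b 0 l) ->
  let r p := f p.1 p.2 * a ^+ p.1 *
    (mon (b 0) p.2 -
      (mon (u 0) p.2 + linmon (u 0) (fun l => b 0 l - u 0 l) p.2)) in
  (forall p, 0 <= r p) /\
  (forall p, multiseries_val f a u +
     \sum_j multiseries_val (dy j f) a u * (b 0 j - u 0 j)%:E + (r p)%:E <=
   multiseries_val f a b)%E.
Proof.
move=> f0 a0 u0 ub r.
pose d l := b 0 l - u 0 l.
have d0 l : 0 <= d l by rewrite subr_ge0.
have c0 (p : nat * {ffun 'I_m -> nat}) : 0 <= f p.1 p.2 * a ^+ p.1.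
  by rewrite mulr_ge0 ?exprn_ge0.
have bE : b 0 = (fun l => u 0 l + d l) :> ('I_m -> R).
  by apply/funext => l; rewrite /d addrC subrK.
have r0 p : 0 <= r p.
  rewrite mulr_ge0 // subr_ge0.
  by have := tangent_mon u0 d0 p.2; rewrite -bE.
split=> // p.
have -> : multiseries_val f a b =
  (\esum_(p in [set: nat * {ffun 'I_m -> nat}])
    ((f p.1 p.2 * a ^+ p.1 * mon (u 0) p.2)%:E +
     (\sum_j (f p.1 p.2 * a ^+ p.1 * dmon (u 0) p.2 j)%:E * (d j)%:E +
      (r p)%:E)))%E.
  rewrite multiseries_valE; apply: eq_esum => q _.
  rewrite sumEFin -!EFinD; congr EFin.
  have -> : \sum_j f q.1 q.2 * a ^+ q.1 * dmon (u 0) q.2 j * d j =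
            f q.1 q.2 * a ^+ q.1 * linmon (u 0) d q.2.
    by rewrite mulr_sumr; apply: eq_bigr => l _; rewrite mulrA.
  by rewrite /r -/d; ring.
have term0 (q : nat * {ffun 'I_m -> nat}) j :
    (0 <= (f q.1 q.2 * a ^+ q.1 * dmon (u 0) q.2 j)%:E * (d j)%:E)%E.
  by rewrite -EFinM lee_fin mulr_ge0 // mulr_ge0 ?dmon_ge0.
have rE (q : nat * {ffun 'I_m -> nat}) : (0 <= (r q)%:E)%E by rewrite lee_fin.
rewrite esumD; first last.
- by move=> q _; apply: adde_ge0 => //; apply: sume_ge0.
- by move=> q _; rewrite lee_fin mulr_ge0 // mon_ge0.
rewrite -addeA -multiseries_valE leeD2l // esumD //; last first.
  by move=> q _; apply: sume_ge0.
apply: leeD; last exact: (@esum_le_term _ _ (fun q => (r q)%:E)).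
rewrite esum_sum //; apply: lee_sum => j _.
under eq_esum do rewrite muleC.
rewrite esumZl //; last first.
  by move=> q; rewrite lee_fin mulr_ge0 ?dmon_ge0.
by rewrite muleC lee_wpmul2l ?lee_fin //; [exact: d0|exact: dy_val_le].
Qed.

End Values.

Lemma ler_sum_inj (R : numDomainType) (S T : finType) (h : S -> T)
    (F : T -> R) :
  injective h -> (forall y, 0 <= F y) -> \sum_x F (h x) <= \sum_y F y.
Proof.
move=> hI F0; rewrite [leRHS](bigID [in [set h x | x : S]%SET]) /=.
rewrite big_imset /=; last by move=> x y _ _ /hI.
by rewrite lerDl sumr_ge0.
Qed.

(** * Coefficientwise domination of polynomials *)

Section CoefDomination.
Variables (R : realType) (M : nat).
Implicit Types p q : {poly R}.

(** The lower bound 0 makes the relation stable under products. The cutoff at [M] allows comparing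
    truncations of different orders, which agree only in low degree. *)
Definition coef_le p q := forall i, (i <= M)%N -> 0 <= p`_i <= q`_i.

Lemma coef_le1 : coef_le 1 1.
Proof. by move=> i _; rewrite coef1 lexx ler0n. Qed.

Lemma coef_leM p1 q1 p2 q2 :
  coef_le p1 q1 -> coef_le p2 q2 -> coef_le (p1 * p2) (q1 * q2).
Proof.
move=> h1 h2 i iM; rewrite !coefM sumr_ge0 /=.
  apply: ler_sum => j _; have jM : (j <= M)%N.
    by apply: leq_trans iM; rewrite -ltnS.
  have /andP[? ?] := h1 _ jM.
  have /andP[? ?] := h2 _ (leq_trans (leq_subr j i) iM).
  exact: ler_pM.
move=> j _; have jM : (j <= M)%N by apply: leq_trans iM; rewrite -ltnS.
have /andP[? ?] := h1 _ jM.
have /andP[? ?] := h2 _ (leq_trans (leq_subr j i) iM).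
by rewrite mulr_ge0.
Qed.

Lemma coef_leX p q n : coef_le p q -> coef_le (p ^+ n) (q ^+ n).
Proof.
move=> h; elim: n => [|n IHn]; first by rewrite !expr0; exact: coef_le1.
by rewrite !exprS; apply: coef_leM.
Qed.

Lemma coef_le_prod (I : finType) (p q : I -> {poly R}) :
  (forall i, coef_le (p i) (q i)) -> coef_le (\prod_i p i) (\prod_i q i).
Proof.
move=> h; apply: (big_ind2 coef_le) => //; first exact: coef_le1.
by move=> *; apply: coef_leM.
Qed.

End CoefDomination.

Lemma sum_coef_le_horner (R : realType) (p : {poly R}) (a : R) N :
  0 <= a -> (forall i, 0 <= p`_i) -> \sum_(l < N) p`_l * a ^+ l <= p.[a].
Proof.
move=> a0 p0; rewrite (horner_coef_wide a (leq_addl N (size p))).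
by rewrite big_split_ord lerDl sumr_ge0 // => l _; rewrite mulr_ge0 ?exprn_ge0.
Qed.

(** * Bounding the standard solution by a nonnegative solution *)

Section StandardSolutionBound.
Variables (R : realType) (m : nat) (G : 'I_m -> multiseries R m).
Variables (t : 'I_m -> nat -> R) (a : R) (b : 'rV[R]_m).
Hypothesis G_ge0 : forall i n k, 0 <= G i n k.
Hypothesis G_x0 : forall i k, G i 0%N k = 0.
Hypothesis ht : standard_solution G t.
Hypothesis a_ge0 : 0 <= a.
Hypothesis b_ge0 : forall i, 0 <= b 0 i.
Hypothesis hb : forall i, multiseries_val (G i) a b = (b 0 i)%:E.

Let P N j : {poly R} := \poly_(l < N.+1) t j l.

(** The index set of the finite sum [subst_coef]. Boxes embed in larger boxes and in the index set
    of [multiseries_val], so nonnegative sums over them can be compared. *)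
Let box N := ('I_N.+1 * {ffun 'I_m -> 'I_N.+1})%type.
Let nat_box N (p : box N) : nat * {ffun 'I_m -> nat} :=
  (p.1 : nat, [ffun j => p.2 j : nat]).
Let widen_box M N (h : (M < N.+1)%N) (p : box M) : box N :=
  (widen_ord h p.1, [ffun j => widen_ord h (p.2 j)]).

Let nat_boxK M N (h : (M < N.+1)%N) (p : box M) :
  nat_box (widen_box h p) = nat_box p.
Proof. by congr pair; apply/ffunP => j; rewrite !ffunE. Qed.

Let nat_box_inj N : injective (@nat_box N).
Proof.
move=> [n k] [n' k'] [/val_inj-> /ffunP e]; congr pair.
by apply/ffunP => j; apply/val_inj; have := e j; rewrite !ffunE.
Qed.

Let widen_box_inj M N (h : (M < N.+1)%N) : injective (widen_box h).
Proof. by move=> p q e; apply: nat_box_inj; rewrite -!(nat_boxK h) e. Qed.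

Let c N (p : nat * {ffun 'I_m -> nat}) : {poly R} :=
  'X^(p.1) * \prod_j P N j ^+ p.2 j.

Let subst_coefE i N :
  subst_coef (G i) t N =
  \sum_(p : box N) G i p.1 (nat_box p).2 * (c N (nat_box p))`_N.
Proof.
rewrite /subst_coef pair_big /=; apply: eq_bigr => p _.
by rewrite /c /=; under [in RHS]eq_bigr do rewrite ffunE.
Qed.

Let P_ge0 N j l : 0 <= (P N j)`_l.
Proof. by rewrite coef_poly; case: ifP => // _; rewrite (ss_ge0 ht). Qed.

Let c_ge0 N p l : 0 <= (c N p)`_l.
Proof.
(* Self-domination amounts to nonnegativity of the coefficients up to degree [l]. *)
have : coef_le l (c N p) (c N p).
  apply: coef_leM; first by move=> k _; rewrite coefXn lexx ler0n.
  by apply: coef_le_prod => j; apply: coef_leX => k _; rewrite lexx P_ge0.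
by move=> /(_ l (leqnn l))/andP[].
Qed.

(* As [G i] has no term of degree 0 in x, the coefficient of x^l only involves
   coefficients of [t] of degree < l. *)
Let coef_c_le i N l p : (l <= N.+1)%N ->
  G i p.1 p.2 * (c l p)`_l <= G i p.1 p.2 * (c N p)`_l.
Proof.
move=> lN; case: p => [[|n] k] /=; first by rewrite G_x0 !mul0r.
rewrite ler_wpM2l // /c !coefXnM /=; case: ltnP => // nl.
have : coef_le N (\prod_j P l j ^+ k j) (\prod_j P N j ^+ k j).
  apply: coef_le_prod => j; apply: coef_leX => q qN.
  rewrite P_ge0 !coef_poly !ltnS qN /=; case: ifP => // _.
  by rewrite (ss_ge0 ht).
have lnN : (l - n.+1 <= N)%N.
  by rewrite leq_subLR addSn; apply: leq_trans lN _; rewrite ltnS leq_addl.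
by move=> /(_ _ lnN)/andP[].
Qed.

(** The truncation of T at order N+1 is dominated by G applied to the truncation at order N. At [a],
    the latter is at most [b] by induction, and G(a, b) = b. *)
Lemma partial_sum_le N j : \sum_(l < N.+1) t j l * a ^+ l <= b 0 j.
Proof.
elim: N j => [|N IHN] j; first by rewrite big_ord1 (ss_0 ht) mul0r.
pose g (p : box N.+1) := G j (nat_box p).1 (nat_box p).2.
have g_ge0 p : 0 <= g p by exact: G_ge0.
(* The sum for [t j l] runs over the box of order [l]; it is enlarged to a common box, and the
   truncation at [l] is replaced by the one at [N]. *)
have t_le (l : 'I_N.+2) :
    t j l <= \sum_(p : box N.+1) g p * (c N (nat_box p))`_l.
  rewrite (ss_fixpoint ht) subst_coefE.
  pose F p := g p * (c N (nat_box p))`_l.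
  have F0 p : 0 <= F p by rewrite /F mulr_ge0.
  apply: le_trans (ler_sum_inj (@widen_box_inj _ _ (ltn_ord l)) F0).
  apply: ler_sum => p _; rewrite /F /g !nat_boxK.
  by apply: (@coef_c_le j N l (nat_box p)); rewrite -ltnS.
have le1 : \sum_(l < N.+2) t j l * a ^+ l <=
    \sum_(p : box N.+1) g p * \sum_(l < N.+2) (c N (nat_box p))`_l * a ^+ l.
  apply: le_trans (_ : \sum_(l < N.+2)
    (\sum_(p : box N.+1) g p * (c N (nat_box p))`_l) * a ^+ l <= _).
    by apply: ler_sum => l _; rewrite ler_wpM2r ?exprn_ge0.
  under eq_bigr do rewrite mulr_suml.
  rewrite exchange_big /=; apply: ler_sum => p _.
  by rewrite mulr_sumr; apply: ler_sum => l _; rewrite mulrA.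
apply: le_trans le1 _; rewrite -lee_fin -hb multiseries_valE.
pose F (p : nat * {ffun 'I_m -> nat}) :=
  (G j p.1 p.2 * a ^+ p.1 * mon (b 0) p.2)%:E.
have F0 p : (0 <= F p)%E.
  by rewrite lee_fin mulr_ge0 ?mon_ge0 // mulr_ge0 ?exprn_ge0.
apply: le_trans (le_esum_inj (@nat_box_inj N.+1) F0).
rewrite esum_finType // -sumEFin; apply: lee_sum => p _.
rewrite lee_fin -mulrA ler_wpM2l //.
apply: le_trans (sum_coef_le_horner _ a_ge0 (c_ge0 _ _)) _.
rewrite /c hornerM hornerXn ler_wpM2l ?exprn_ge0 // horner_prod.
(* The value of [P N l] at [a] is the partial sum bounded by the induction hypothesis. *)
apply: ler_prod => l _; rewrite horner_exp horner_poly.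
rewrite exprn_ge0 /=; last first.
  by apply: sumr_ge0 => q _; rewrite mulr_ge0 ?exprn_ge0 ?(ss_ge0 ht).
apply: lerXn2r => //; rewrite nnegrE ?sumr_ge0 // => q _.
by rewrite mulr_ge0 ?exprn_ge0 ?(ss_ge0 ht).
Qed.

Lemma pseries_cvg_le j :
  cvgn (pseries (t j) a) /\ (forall n, pseries (t j) a n <= b 0 j).
Proof.
have bnd n : pseries (t j) a n <= b 0 j.
  (* [pseries] at [n] has only the terms of index below [n]; the bound has one more, nonnegative,
     term. *)
  apply: le_trans (partial_sum_le n j).
  rewrite /pseries /series /= big_mkord [leRHS]big_ord_recr /= lerDl.
  by rewrite mulr_ge0 ?exprn_ge0 ?(ss_ge0 ht).
split=> //; apply: nondecreasing_is_cvgn.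
  apply: nondecreasing_series => n _ _.
  by rewrite mulr_ge0 ?exprn_ge0 ?(ss_ge0 ht).
by exists (b 0 j) => _ [n _ <-].
Qed.

End StandardSolutionBound.

(** * Comparison with the extreme point, and uniqueness *)

Lemma positive_solution_le (R : realType) (m : nat) (hm : (0 < m)%N)
    (G : 'I_m -> multiseries R m) (rho a : R) (tau b : 'rV[R]_m) :
  well_conditioned G -> extreme_point G rho tau -> 0 <= a ->
  (forall i, 0 <= b 0 i) ->
  (forall i, multiseries_val (G i) a b = (b 0 i)%:E) -> a <= rho.
Proof.
move=> wc [t ht tau_rho] a0 b0 hb.
have [crt _] := tau_rho (Ordinal hm).
rewrite -lee_fin -crt; apply: ereal_sup_ubound.
exists a; last by rewrite ger0_norm.
exact: (pseries_cvg_le (wc_ge0 wc) (wc_x0 wc) ht a0 b0 hb _).1.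
Qed.

Lemma extreme_point_le (R : realType) (m : nat)
    (G : 'I_m -> multiseries R m) (rho : R) (tau b : 'rV[R]_m) :
  well_conditioned G -> extreme_point G rho tau -> 0 <= rho ->
  (forall i, 0 <= b 0 i) ->
  (forall i, multiseries_val (G i) rho b = (b 0 i)%:E) ->
  forall i, tau 0 i <= b 0 i.
Proof.
move=> wc [t ht tau_rho] rho0 b0 hb i; have [_ cv] := tau_rho i.
have [cvt bnd] := pseries_cvg_le (wc_ge0 wc) (wc_x0 wc) ht rho0 b0 hb i.
rewrite -(cvg_lim _ cv) //; apply: limr_le => //.
by apply: nearW => n; exact: bnd.
Qed.

Lemma characteristic_point_unique (R : realType) (m : nat)
    (G : 'I_m -> multiseries R m) (a : R) (u b : 'rV[R]_m) :
  well_conditioned G -> characteristic_point G a u ->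
  (forall i, multiseries_val (G i) a b = (b 0 i)%:E) ->
  (forall i, u 0 i <= b 0 i) -> b = u.
Proof.
move=> wc cp hb ub; have G0 := wc_ge0 wc.
have a0 := ltW (cp_a_gt0 cp).
have ugt0 := cp_b_gt0 cp.
have u0 i := ltW (ugt0 i).
pose d i := b 0 i - u 0 i.
pose A := jacobian_y G a u.
have dy0 i j n k : 0 <= dy j (G i) n k by rewrite mulr_ge0.
have dyterm0 i j (p : nat * {ffun 'I_m -> nat}) :
    (0 <= (dy j (G i) p.1 p.2 * a ^+ p.1 * mon (u 0) p.2)%:E)%E.
  by rewrite lee_fin mulr_ge0 ?mon_ge0 // mulr_ge0 ?exprn_ge0.
have val0 i j : (0 <= multiseries_val (dy j (G i)) a u)%E.
  by apply: esum_ge0 => p _; exact: dyterm0.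
have AE i j : multiseries_val (dy j (G i)) a u = (A i j)%:E.
  by rewrite mxE fineK // ge0_fin_numE //; exact: cp_jacobian_cvg cp _ _.
have A0 i j : 0 <= A i j by rewrite mxE fine_ge0.
have Airr i j : connect [rel i j | 0 < A i j] i j.
  (* A nonzero coefficient of a derivative contributes a positive term at the positive point (a, u),
     so every dependency edge is an edge of the graph of [A]. *)
  apply: connect_sub (wc_irreducible wc i j) => {}i {}j.
  move=> /asboolP[n [k nz]]; apply: connect1 => /=.
  rewrite -lte_fin -AE multiseries_valE.
  apply: lt_le_trans (esum_le_term (n, k) (dyterm0 i j)).
  rewrite lte_fin mulr_gt0 ?mon_gt0 // mulr_gt0 ?exprn_gt0 ?(cp_a_gt0 cp) //.
  by rewrite lt_def nz dy0.
pose r i (p : nat * {ffun 'I_m -> nat}) := G i p.1 p.2 * a ^+ p.1 *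
    (mon (b 0) p.2 - (mon (u 0) p.2 + linmon (u 0) d p.2)).
have [r0 rle] : (forall i p, 0 <= r i p) /\
    (forall i p, \sum_j A i j * d j + r i p <= d i).
  split=> i p; have [r0 rle] := multiseries_tangent (G0 i) a0 u0 ub.
    exact: r0.
  have := rle p; rewrite hb (cp_solution cp).
  under eq_bigr do rewrite AE -EFinM.
  by rewrite sumEFin -!EFinD lee_fin -addrA -lerBrDl.
have d0 i : 0 <= d i by rewrite subr_ge0.
have Ad i : \sum_j A i j * d j <= d i.
  by apply: le_trans (rle i (0%N, [ffun=> 0%N])); rewrite lerDl.
apply/rowP => i0; apply/eqP; apply: contraT => neq.
have di0 : 0 < d i0 by rewrite lt_def d0 subr_eq0 neq.
have d_gt0 := subinvariant_gt0 A0 Airr d0 Ad di0.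
have eqd := subinvariant_eq A0 Airr d0 Ad di0 (cp_det cp).
(* A nonzero second derivative yields a nonzero coefficient of [G i] at a monomial divisible by y_j
   y_k. Its gap is positive, whereas A d = d leaves no room for one. *)
have [i [j [k [n [e]]]]] := wc_nonlinear wc.
rewrite !mulf_eq0 !negb_or => /and3P[_ _ nz].
have := rle i (n, incr j (incr k e)).
rewrite eqd gerDl leNgt => /negP[].
rewrite /r /= mulr_gt0 //.
  by rewrite mulr_gt0 ?exprn_gt0 ?(cp_a_gt0 cp) // lt_def nz G0.
rewrite subr_gt0.
have := tangent_mon_lt u0 d0 e ugt0 (d_gt0 k) (d_gt0 j).
suff -> : (fun l => u 0 l + d l) = b 0 by [].
by apply/funext => l; rewrite /d addrC subrK.
Qed.

Theorem theorem14 (R : realType) (m : nat) (hm : (0 < m)%N)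
    (G : 'I_m -> multiseries R m) (rho : R) (tau : 'rV[R]_m)
    (hG : well_conditioned G)
    (hext : extreme_point G rho tau)
    (hchar : characteristic_point G rho tau) :
  (let A := [set a : R | exists b : 'rV[R]_m, characteristic_point G a b] in
   A rho /\ ubound A rho) /\
  (forall b : 'rV[R]_m, characteristic_point G rho b -> b = tau).
Proof.
split; [split|].
- by exists tau.
- move=> a [b cp].
  exact: (positive_solution_le hm hG hext (ltW (cp_a_gt0 cp))
    (fun i => ltW (cp_b_gt0 cp i)) (cp_solution cp)).
- move=> b cp.
  apply: (characteristic_point_unique hG hchar (cp_solution cp)).
  exact: (extreme_point_le hG hext (ltW (cp_a_gt0 cp))
    (fun i => ltW (cp_b_gt0 cp i)) (cp_solution cp)).
Qed.
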